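(* Let $(\mathcal{X},\top,\Gamma,\Pi_r)$ be an associative geometry over $\mathbb{K}$. (i) Assume $\mathcal{X}$ admits a transversal pair, which we take as base point $(o^+,o^-)$. Then, letting $\mathbb{A}^+:=U_{o^-}$ and $\mathbb{A}^-:=U_{o^+}$, the pair of $\mathbb{K}$-modules $(\mathbb{A}^+,\mathbb{A}^-)$ with origins $o^+$, resp. $o^-$, becomes an associative pair when equipped with $$\langle xbz\rangle^+:=\Gamma(x,o^-,b,o^+,z),\qquad \langle ayc\rangle^-:=\Gamma(a,o^-,y,o^+,c)$$ ($x,z,y\in\mathbb{A}^+$, $a,b,c\in\mathbb{A}^-$). This construction is functorial: base-point-preserving homomorphisms of associative geometries restrict to homomorphisms of the associated associative pairs, compatibly with identities and composition. (ii) Assume $\mathcal{X}$ admits a transversal triple $(a,b,c)$ (three mutually transversal elements). Then, letting $\mathbb{A}:=U_c$, the $\mathbb{K}$-module $\mathbb{A}$ with origin $o^+:=a$ becomes an associative unital algebra over $\mathbb{K}$ with unit $u:=b$ and product map $$\mathbb{A}\times\mathbb{A}\to\mathbb{A},\quad (x,z)\mapsto xz:=\Gamma(x,a,u,c,z).$$ This construction is functorial: homomorphisms of associative geometries mapping the chosen transversal triple to the chosen transversal triple restrict to homomorphisms of the associated unital algebras, compatibly with identities and composition.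
   Context: $\mathbb{K}$ is a commutative unital ring. An associative geometry over $\mathbb{K}$ is a set $\mathcal{X}$ which is a complete lattice (join $\lor$, meet $\land$, least element $0$, greatest element $1$) with maps $\Gamma:\mathcal{X}^5\to\mathcal{X}$ and $\Pi_s:\mathcal{X}^3\to\mathcal{X}$ ($s\in\mathbb{K}$) satisfying (1)–(6) below. Notation: $L_{xayb}(z):=M_{xabz}(y):=R_{aybz}(x):=\Gamma(x,a,y,b,z)$; $x\top y$ (transversal) means $x\land y=0$ and $x\lor y=1$; $C_a=\{x: x\top a\}$, $C_{ab}=C_a\cap C_b$; $U_a$ denotes $C_a$ with the affine structure of (5). (1) For all $x,y,z,u,v,a,b$: $\Gamma(\Gamma(x,a,y,b,z),a,u,b,v)=\Gamma(x,a,\Gamma(u,a,z,b,y),b,v)=\Gamma(x,a,y,b,\Gamma(z,a,u,b,v))$. (2) For all $x,a,y,b,z$: $\Gamma(x,a,y,b,z)=\Gamma(z,b,y,a,x)$ and $\Gamma(x,a,y,b,z)=\Gamma(a,x,y,z,b)$. (3) For all $x,a,y,b,z$, the pairs $(L_{xayb},L_{yaxb})$, $(M_{xabz},M_{zabx})$, $(R_{aybz},R_{azby})$ are structural; a pair $g:\mathcal{X}\to\mathcal{Y}$, $h:\mathcal{Y}\to\mathcal{X}$ is structural if $g(\Gamma(x,h(u),y,h(v),z))=\Gamma(g(x),u,g(y),v,g(z))$ and $g(\Pi_r(x,h(u),y))=\Pi_r(g(x),u,g(y))$ for all arguments and all $r\in\mathbb{K}$, and likewise with $g,h$ exchanged.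 (4) (i) $\Gamma(a,a,y,b,b)=a\lor b$ for all $a,b,y$; (ii) $\Gamma(a,b,y,a,b)=a\land b$ for all $a,b,y$; (iii) if $x\in C_{ab}$ then $\Gamma(x,a,x,b,z)=z=\Gamma(z,b,x,a,x)$ for all $z$; (iv) if $a\top x$ and $y\top b$ then $\Gamma(x,a,y,b,b)=b$; (v) if $a\top y$ and $b\top x$ then $\Gamma(x,a,y,b,a)=a$. (5) For all $a\in\mathcal{X}$, $r\in\mathbb{K}$: $\Pi_r(x,a,y)\in C_a$ for $x,y\in C_a$, and $C_a$ is an affine space over $\mathbb{K}$ with additive torsor structure $x-y+z=\Gamma(x,a,y,a,z)$ and scalar action $r\cdot_x y=(1-r)x+ry=\Pi_r(x,a,y)$. (Thus choosing an origin $o\in C_a$ makes $C_a$ a $\mathbb{K}$-module with addition $x+z=\Gamma(x,a,o,a,z)$ and scalars $r\cdot y=\Pi_r(o,a,y)$.) (6) For all $a,b$: $\Gamma(U_a,a,U_b,b,U_a)\subset U_a$ and $\Gamma(U_b,a,U_a,b,U_b)\subset U_b$. A base point is a transversal pair $(o^+,o^-)$. A homomorphism of associative geometries is a map $\phi:\mathcal{X}\to\mathcal{Y}$ with $\phi(\Gamma(x,a,y,b,z))=\Gamma(\phi x,\phi a,\phi y,\phi b,\phi z)$ and $\phi(\Pi_r(x,a,y))=\Pi_r(\phi x,\phi a,\phi y)$ for all arguments and all $r$. An associative pair over $\mathbb{K}$ is a pair $(\mathbb{A}^+,\mathbb{A}^-)$ of $\mathbb{K}$-modules with trilinear maps $\langle\cdot\,\cdot\,\cdot\rangle^\pm:\mathbb{A}^\pm\times\mathbb{A}^\mp\times\mathbb{A}^\pm\to\mathbb{A}^\pm$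 satisfying $\langle xy\langle zuv\rangle^\pm\rangle^\pm=\langle\langle xyz\rangle^\pm uv\rangle^\pm=\langle x\langle uzy\rangle^\mp v\rangle^\pm$. Homomorphisms of associative pairs are pairs of $\mathbb{K}$-linear maps $\mathbb{A}^\pm\to(\mathbb{A}')^\pm$ commuting with the triple products. *)

(* Defs.v *)
From HB Require Import structures.
From mathcomp Require Import all_boot all_order all_algebra.
From mathcomp Require Import classical_sets.

Set Implicit Arguments.
Unset Strict Implicit.
Unset Printing Implicit Defensive.

Import Order.TTheory GRing.Theory.
Local Open Scope ring_scope.

(* Commutative unital rings are comPzRingType and unital algebras are given by
   a predicate on a module, rather than comNzRingType and algType, because the
   latter exclude the zero ring. *)

Definition complete_lattice d (L : tbLatticeType d) : Prop :=
  forall A : set L, nonempty (supremums A) /\ nonempty (infimums A).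

Definition transverse d (L : tbLatticeType d) (x y : L) : bool :=
  ((x `&` y == \bot) && (x `|` y == \top))%O.

Lemma transverseC d (L : tbLatticeType d) (x y : L) :
  transverse x y = transverse y x.
Proof. by rewrite /transverse meetC joinC. Qed.

(* An affine space may be empty: the points are a torsor under the module
   [direction] only in the sense that [translate] is free and transitive. *)
Record affineSpace (K : comPzRingType) (P : Type) := AffineSpace {
  direction : lmodType K;
  translate : P -> direction -> P;
  displacement : P -> P -> direction;
  translateD : forall p u v,
    translate (translate p u) v = translate p (u + v);
  displacementK : forall p q, translate p (displacement p q) = q;
  translateK : forall p v, displacement p (translate p v) = v
}.

(* x - y + z *)
Definition affine_torsor K P (S : affineSpace K P) (x y z : P) : P :=
  translate x (displacement S y z).

(* (1 - r) x + r y *)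
Definition affine_dilation K P (S : affineSpace K P) (r : K) (x y : P) : P :=
  translate x (r *: displacement S x y).

Section GeometryLaws.
Variables (K : comPzRingType) (d : Order.disp_t) (X : tbLatticeType d).
Variables (G : X -> X -> X -> X -> X -> X) (P : K -> X -> X -> X -> X).

Definition semistructural (g h : X -> X) : Prop :=
  (forall x u y v z, g (G x (h u) y (h v) z) = G (g x) u (g y) v (g z)) /\
  (forall r x u y, g (P r x (h u) y) = P r (g x) u (g y)).

Definition structural (g h : X -> X) : Prop :=
  semistructural g h /\ semistructural h g.

Let L x a y b := fun z => G x a y b z.
Let M x a b z := fun y => G x a y b z.
Let R a y b z := fun x => G x a y b z.

Definition para_associative : Prop := forall x y z u v a b,
  G (G x a y b z) a u b v = G x a (G u a z b y) b v /\
  G x a (G u a z b y) b v = G x a y b (G z a u b v).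

Definition klein_symmetric : Prop := forall x a y b z,
  G x a y b z = G z b y a x /\ G x a y b z = G a x y z b.

Definition translations_structural : Prop := forall x a y b z,
  [/\ structural (L x a y b) (L y a x b),
      structural (M x a b z) (M z a b x) &
      structural (R a y b z) (R a z b y)].

Definition diagonal_values : Prop :=
  [/\ forall a b y, G a a y b b = (a `|` b)%O,
      forall a b y, G a b y a b = (a `&` b)%O,
      forall x a b z, transverse x a -> transverse x b ->
        G x a x b z = z /\ z = G z b x a x,
      forall x a y b, transverse a x -> transverse y b -> G x a y b b = b &
      forall x a y b, transverse a y -> transverse b x -> G x a y b a = a].

Definition affine_parts : Prop := forall a : X,
  (forall r x y, transverse x a -> transverse y a ->
     transverse (P r x a y) a) /\
  exists S : affineSpace K {x : X | transverse x a},
    (forall x y z,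
       \val (affine_torsor S x y z) = G (\val x) a (\val y) a (\val z)) /\
    (forall r x y,
       \val (affine_dilation S r x y) = P r (\val x) a (\val y)).

Definition semitorsor_stable : Prop := forall a b x y z : X,
  (transverse x a -> transverse y b -> transverse z a ->
     transverse (G x a y b z) a) /\
  (transverse x b -> transverse y a -> transverse z b ->
     transverse (G x a y b z) b).

End GeometryLaws.

Record assocGeom (K : comPzRingType) := AssocGeom {
  ag_disp : Order.disp_t;
  ag_carrier :> tbLatticeType ag_disp;
  Gam : ag_carrier -> ag_carrier -> ag_carrier -> ag_carrier -> ag_carrier ->
        ag_carrier;
  Pi : K -> ag_carrier -> ag_carrier -> ag_carrier -> ag_carrier;
  ag_complete : complete_lattice ag_carrier;
  ag_assoc : para_associative Gam;
  ag_klein : klein_symmetric Gam;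
  ag_structural : translations_structural Gam Pi;
  ag_diagonal : diagonal_values Gam;
  ag_affine : affine_parts Gam Pi;
  ag_stable : semitorsor_stable Gam
}.

Record assocGeomHom (K : comPzRingType) (X Y : assocGeom K) := AssocGeomHom {
  agh_fun :> X -> Y;
  agh_Gam : forall x a y b z, agh_fun (Gam x a y b z) =
    Gam (agh_fun x) (agh_fun a) (agh_fun y) (agh_fun b) (agh_fun z);
  agh_Pi : forall r x a y,
    agh_fun (Pi r x a y) = Pi r (agh_fun x) (agh_fun a) (agh_fun y)
}.

Definition agh_id K (X : assocGeom K) : assocGeomHom X X :=
  @AssocGeomHom K X X id (fun _ _ _ _ _ => erefl) (fun _ _ _ _ => erefl).

Lemma agh_comp_Gam K (X Y Z : assocGeom K) (g : assocGeomHom Y Z)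
    (f : assocGeomHom X Y) x a y b z :
  (g \o f) (Gam x a y b z) =
  Gam ((g \o f) x) ((g \o f) a) ((g \o f) y) ((g \o f) b) ((g \o f) z).
Proof. by rewrite /= !agh_Gam. Qed.

Lemma agh_comp_Pi K (X Y Z : assocGeom K) (g : assocGeomHom Y Z)
    (f : assocGeomHom X Y) r x a y :
  (g \o f) (Pi r x a y) = Pi r ((g \o f) x) ((g \o f) a) ((g \o f) y).
Proof. by rewrite /= !agh_Pi. Qed.

Definition agh_comp K (X Y Z : assocGeom K) (g : assocGeomHom Y Z)
    (f : assocGeomHom X Y) : assocGeomHom X Z :=
  AssocGeomHom (agh_comp_Gam g f) (agh_comp_Pi g f).

(* U_a with origin o; the proof oa is a parameter of the type so that the
   module structure can depend on the origin. *)
Definition affineU (K : comPzRingType) (X : assocGeom K) (a o : X)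
  (oa : transverse o a) : Type := {x : X | transverse x a}.

Section AffineUModule.
Variables (K : comPzRingType) (X : assocGeom K) (a o : X).
Hypothesis oa : transverse o a.
Local Notation U := (affineU oa).

Definition toU (x : X) (xa : transverse x a) : U :=
  @exist X (fun x => transverse x a) x xa.

HB.instance Definition _ := SubType.copy U {x : X | transverse x a}.
HB.instance Definition _ := [Choice of U by <:].

Lemma affineU_addP (x z : U) : transverse (Gam (\val x) a o a (\val z)) a.
Proof. exact: (ag_stable a a _ _ _).1 (valP x) oa (valP z). Qed.

Lemma affineU_oppP (x : U) : transverse (Gam o a (\val x) a o) a.
Proof. exact: (ag_stable a a _ _ _).1 oa (valP x) oa. Qed.

Lemma affineU_scaleP r (x : U) : transverse (Pi r o a (\val x)) a.
Proof. exact: (ag_affine a).1 oa (valP x). Qed.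

Definition affineU_zero : U := toU oa.
Definition affineU_add (x z : U) : U := toU (affineU_addP x z).
Definition affineU_opp (x : U) : U := toU (affineU_oppP x).
Definition affineU_scale r (x : U) : U := toU (affineU_scaleP r x).

Lemma affineU_vec : exists (V : lmodType K) (v : U -> V),
  [/\ injective v, v affineU_zero = 0,
      forall x z, v (affineU_add x z) = v x + v z,
      forall x, v (affineU_opp x) = - v x &
      forall r x, v (affineU_scale r x) = r *: v x].
Proof.
have [_ [S [ST SD]]] := ag_affine a.
pose v (x : U) := displacement S affineU_zero x.
have tr0 p : translate (a := S) p 0 = p.
  by rewrite -{1}(displacementK S p p) translateD addr0 displacementK.
have vt p (x : U) : v (translate p (displacement S x affineU_zero)) = v p - v x.
  have -> : displacement S x affineU_zero = - v x.
    apply/eqP; rewrite -addr_eq0 addrC; apply/eqP.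
    by rewrite -(translateK affineU_zero (v x + _)) -translateD
         !displacementK -{2}(tr0 affineU_zero) translateK.
  by rewrite -{1}(displacementK S affineU_zero p) translateD /v translateK.
have v0 : v affineU_zero = 0 by rewrite /v -{2}(tr0 affineU_zero) translateK.
have vT (x y z : U) : v (affine_torsor S x y z) = v x - v y + v z.
  rewrite /affine_torsor -{1}(displacementK S affineU_zero x) translateD.
  rewrite /v translateK -addrA; congr (_ + _).
  apply/eqP; rewrite -(subr_eq0); apply/eqP.
  have <- : displacement S y (translate y (- v y + v z)) = - v y + v z.
    by rewrite translateK.
  rewrite -{3}(displacementK S affineU_zero y) translateD addrA subrr add0r.
  by rewrite displacementK subrr.
exists (direction S), v; split => //.
- by move=> x y vxy; rewrite -(displacementK S affineU_zero x) -/(v x) vxy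
       displacementK.
- move=> x z; have <- : affine_torsor S x affineU_zero z = affineU_add x z.
    by apply: val_inj; rewrite ST.
  by rewrite vT v0 subr0.
- move=> x.
  have <- : affine_torsor S affineU_zero x affineU_zero = affineU_opp x.
    by apply: val_inj; rewrite ST.
  by rewrite vT v0 add0r addr0.
- move=> r x.
  have <- : affine_dilation S r affineU_zero x = affineU_scale r x.
    by apply: val_inj; rewrite SD.
  by rewrite /v translateK.
Qed.

Lemma affineU_addA : associative affineU_add.
Proof.
have [V [v [vI v0 vD vN vZ]]] := affineU_vec.
by move=> x y z; apply: vI; rewrite !vD addrA.
Qed.

Lemma affineU_addC : commutative affineU_add.
Proof.
have [V [v [vI v0 vD vN vZ]]] := affineU_vec.
by move=> x y; apply: vI; rewrite !vD addrC.
Qed.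

Lemma affineU_add0 : left_id affineU_zero affineU_add.
Proof.
have [V [v [vI v0 vD vN vZ]]] := affineU_vec.
by move=> x; apply: vI; rewrite vD v0 add0r.
Qed.

Lemma affineU_addN : left_inverse affineU_zero affineU_opp affineU_add.
Proof.
have [V [v [vI v0 vD vN vZ]]] := affineU_vec.
by move=> x; apply: vI; rewrite vD vN v0 addNr.
Qed.

HB.instance Definition _ := GRing.isZmodule.Build U
  affineU_addA affineU_addC affineU_add0 affineU_addN.

Lemma affineU_scaleA r s (x : U) :
  affineU_scale r (affineU_scale s x) = affineU_scale (r * s) x.
Proof.
have [V [v [vI v0 vD vN vZ]]] := affineU_vec.
by apply: vI; rewrite !vZ scalerA.
Qed.

Lemma affineU_scale1 : left_id 1 affineU_scale.
Proof.
have [V [v [vI v0 vD vN vZ]]] := affineU_vec.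
by move=> x; apply: vI; rewrite vZ scale1r.
Qed.

Lemma affineU_scaleDr : right_distributive affineU_scale +%R.
Proof.
have [V [v [vI v0 vD vN vZ]]] := affineU_vec.
by move=> r x y; apply: vI; rewrite vD !vZ vD scalerDr.
Qed.

Lemma affineU_scaleDl (x : U) : {morph affineU_scale^~ x : r s / r + s}.
Proof.
have [V [v [vI v0 vD vN vZ]]] := affineU_vec.
by move=> r s; apply: vI; rewrite vD !vZ scalerDl.
Qed.

HB.instance Definition _ := GRing.Zmodule_isLmodule.Build K U
  affineU_scaleA affineU_scale1 affineU_scaleDr affineU_scaleDl.

End AffineUModule.

Definition trilinear (K : pzRingType) (A B C D : lmodType K)
    (t : A -> B -> C -> D) : Prop :=
  [/\ forall y z, linear (fun x => t x y z),
      forall x z, linear (fun y => t x y z) &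
      forall x y, linear (fun z => t x y z)].

Definition pair_associative (A B : Type)
    (tp : A -> B -> A -> A) (tm : B -> A -> B -> B) : Prop :=
  forall x y z u v,
    tp x y (tp z u v) = tp (tp x y z) u v /\
    tp (tp x y z) u v = tp x (tm u z y) v.

Definition is_assocPair (K : comPzRingType) (A B : lmodType K)
    (tp : A -> B -> A -> A) (tm : B -> A -> B -> B) : Prop :=
  [/\ trilinear tp, trilinear tm,
      pair_associative tp tm & pair_associative tm tp].

Record assocPair (K : comPzRingType) := AssocPair {
  ap_plus : lmodType K;
  ap_minus : lmodType K;
  ap_triplep : ap_plus -> ap_minus -> ap_plus -> ap_plus;
  ap_triplem : ap_minus -> ap_plus -> ap_minus -> ap_minus;
  ap_axioms : is_assocPair ap_triplep ap_triplem
}.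

Record assocPairHom (K : comPzRingType) (A B : assocPair K) := AssocPairHom {
  aph_plus : {linear ap_plus A -> ap_plus B};
  aph_minus : {linear ap_minus A -> ap_minus B};
  aph_triplep : forall x y z, aph_plus (ap_triplep x y z) =
    ap_triplep (aph_plus x) (aph_minus y) (aph_plus z);
  aph_triplem : forall x y z, aph_minus (ap_triplem x y z) =
    ap_triplem (aph_minus x) (aph_plus y) (aph_minus z)
}.

Definition is_unitalAlg (K : comPzRingType) (A : lmodType K)
    (mul : A -> A -> A) (one : A) : Prop :=
  [/\ forall y, linear (fun x => mul x y), forall x, linear (mul x),
      associative mul, left_id one mul & right_id one mul].

Record unitalAlg (K : comPzRingType) := UnitalAlg {
  ua_sort : lmodType K;
  ua_mul : ua_sort -> ua_sort -> ua_sort;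
  ua_one : ua_sort;
  ua_axioms : is_unitalAlg ua_mul ua_one
}.

Record unitalAlgHom (K : comPzRingType) (A B : unitalAlg K) := UnitalAlgHom {
  uah_fun :> {linear ua_sort A -> ua_sort B};
  uah_mul : forall x y, uah_fun (ua_mul x y) = ua_mul (uah_fun x) (uah_fun y);
  uah_one : uah_fun (ua_one A) = ua_one B
}.

Record basedGeom (K : comPzRingType) := BasedGeom {
  bg_geom :> assocGeom K;
  bplus : bg_geom;
  bminus : bg_geom;
  bg_transversal : transverse bplus bminus
}.

Record basedHom (K : comPzRingType) (X Y : basedGeom K) := BasedHom {
  bgh_hom :> assocGeomHom X Y;
  bgh_plus : bgh_hom (bplus X) = bplus Y;
  bgh_minus : bgh_hom (bminus X) = bminus Y
}.

Definition bgh_id K (X : basedGeom K) : basedHom X X :=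
  @BasedHom K X X (agh_id X) erefl erefl.

Definition bgh_comp K (X Y Z : basedGeom K) (g : basedHom Y Z)
    (f : basedHom X Y) : basedHom X Z :=
  @BasedHom K X Z (agh_comp g f)
    (etrans (congr1 g (bgh_plus f)) (bgh_plus g))
    (etrans (congr1 g (bgh_minus f)) (bgh_minus g)).

Section GeomPair.
Variables (K : comPzRingType) (X : basedGeom K).
Local Notation op := (bplus X).
Local Notation om := (bminus X).

Lemma bg_transversalC : transverse om op.
Proof. by rewrite transverseC bg_transversal. Qed.

Definition geomAplus : lmodType K := affineU (bg_transversal X).
Definition geomAminus : lmodType K := affineU bg_transversalC.

Lemma geom_triplep_subproof (x : geomAplus) (b : geomAminus) (z : geomAplus) :
  transverse (Gam (\val x) om (\val b) op (\val z)) om.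
Proof. exact: (ag_stable om op _ _ _).1 (valP x) (valP b) (valP z). Qed.

Lemma geom_triplem_subproof (a : geomAminus) (y : geomAplus) (c : geomAminus) :
  transverse (Gam (\val a) om (\val y) op (\val c)) op.
Proof. exact: (ag_stable om op _ _ _).2 (valP a) (valP y) (valP c). Qed.

Definition geom_triplep (x : geomAplus) (b : geomAminus) (z : geomAplus) :
  geomAplus := toU _ (geom_triplep_subproof x b z).

Definition geom_triplem (a : geomAminus) (y : geomAplus) (c : geomAminus) :
  geomAminus := toU _ (geom_triplem_subproof a y c).

End GeomPair.

Record tripledGeom (K : comPzRingType) := TripledGeom {
  tg_geom :> assocGeom K;
  tri_a : tg_geom;
  tri_b : tg_geom;
  tri_c : tg_geom;
  tg_ab : transverse tri_a tri_b;
  tg_bc : transverse tri_b tri_c;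
  tg_ac : transverse tri_a tri_c
}.

Record tripledHom (K : comPzRingType) (X Y : tripledGeom K) := TripledHom {
  tgh_hom :> assocGeomHom X Y;
  tgh_a : tgh_hom (tri_a X) = tri_a Y;
  tgh_b : tgh_hom (tri_b X) = tri_b Y;
  tgh_c : tgh_hom (tri_c X) = tri_c Y
}.

Definition tgh_id K (X : tripledGeom K) : tripledHom X X :=
  @TripledHom K X X (agh_id X) erefl erefl erefl.

Definition tgh_comp K (X Y Z : tripledGeom K) (g : tripledHom Y Z)
    (f : tripledHom X Y) : tripledHom X Z :=
  @TripledHom K X Z (agh_comp g f)
    (etrans (congr1 g (tgh_a f)) (tgh_a g))
    (etrans (congr1 g (tgh_b f)) (tgh_b g))
    (etrans (congr1 g (tgh_c f)) (tgh_c g)).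

Section GeomAlg.
Variables (K : comPzRingType) (X : tripledGeom K).
Local Notation a := (tri_a X).
Local Notation u := (tri_b X).
Local Notation c := (tri_c X).

Definition geomA : lmodType K := affineU (tg_ac X).

Lemma geom_mul_subproof (x z : geomA) :
  transverse (Gam (\val x) a u c (\val z)) c.
Proof.
apply: (ag_stable a c _ _ _).2 (valP x) _ (valP z).
by rewrite transverseC tg_ab.
Qed.

Definition geom_mul (x z : geomA) : geomA :=
  toU _ (geom_mul_subproof x z).

Definition geom_unit : geomA := toU _ (tg_bc X).

End GeomAlg.

(* Main.v *)
(* Each of the operators L, M and R of Gam, taken at elements transversal to the
   base points, has a structural partner, and by the diagonal values both fix or
   exchange the base points. Structurality then says that the operator commutes
   with the affine operations and respects the origins, i.e. that it is linear.
   Associativity is the para-associative law itself. A homomorphism commutes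
   with the affine operations by definition, and preserves transversality
   because join and meet are values of Gam. *)

Require Import Defs.
From HB Require Import structures.
From mathcomp Require Import all_boot all_order all_algebra.

Set Implicit Arguments.
Unset Strict Implicit.
Unset Printing Implicit Defensive.

Import GRing.Theory.
Local Open Scope ring_scope.

(** * Linearity from compatibility with affine operations *)

Section AffineLinear.
Variables (K : comPzRingType) (X Y : assocGeom K).

(** The sum in [affineU] is [Gam x a o a z] and the scalar multiple is [Pi r o a x], so it suffices
    that [h] respects these operations and the origin. Two geometries occur because [h] is later
    either an operator of [Gam] or a homomorphism. *)
Lemma affineU_linear (a o : X) (a' o' : Y) (oa : transverse o a)
    (oa' : transverse o' a') (h : X -> Y) (f : affineU oa -> affineU oa') :
  (forall x, \val (f x) = h (\val x)) -> h o = o' ->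
  (forall p q r, h (Gam p a q a r) = Gam (h p) a' (h q) a' (h r)) ->
  (forall r p q, h (Pi r p a q) = Pi r (h p) a' (h q)) ->
  linear f.
Proof.
move=> fE ho hG hP r x y; apply: val_inj; rewrite fE /=.
by rewrite hG hP ho -!fE.
Qed.

End AffineLinear.

Section DiagonalValues.
Variables (K : comPzRingType) (X : assocGeom K).

(** Structurality is applied at [u = v = a'], where [h a' = a] turns its left-hand sides into affine
    operations with base [a]. *)
Lemma semistructural_linear (a o a' o' : X) (oa : transverse o a)
    (oa' : transverse o' a') (g h : X -> X) (f : affineU oa -> affineU oa') :
  semistructural (@Gam K X) (@Pi K X) g h -> h a' = a -> g o = o' ->
  (forall x, \val (f x) = g (\val x)) -> linear f.
Proof.
move=> [gG gP] ha go fE; apply: (affineU_linear fE go).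
  by move=> p q r; rewrite -{1 2}ha gG.
by move=> r p q; rewrite -{1}ha gP.
Qed.

Variables (a b : X).

Lemma Gam_rightE x y : transverse x a -> transverse y b ->
  Gam x a y b b = b.
Proof.
move=> xa yb; have [_ _ _ + _] := @ag_diagonal K X; apply=> //.
by rewrite transverseC.
Qed.

Lemma Gam_right_swapE x y : transverse x a -> transverse y b ->
  Gam y a x b a = a.
Proof.
move=> xa yb; have [_ _ _ _] := @ag_diagonal K X; apply.
all: by rewrite transverseC.
Qed.

Lemma Gam_midE x z : transverse x a -> transverse z a -> Gam x a a b z = b.
Proof.
move=> xa za; have [_ _ + _ _] := @ag_diagonal K X.
(* The Klein symmetry rewrites the value as [Gam a x a z b], and [a] is transversal to both [x] and
   [z]. *)
rewrite (ag_klein _ _ _ _ _).2 => /(_ a x z b).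
by rewrite ![transverse a _]transverseC; case.
Qed.

End DiagonalValues.

(** * Linearity of the triple product in each argument *)

Section TripleLinear.
Variables (K : comPzRingType) (X : assocGeom K).
Variables (a b : X) (ba : transverse b a) (ab : transverse a b).

Lemma Gam_linear_right x y (f : affineU ba -> affineU ba) :
  transverse x a -> transverse y b ->
  (forall z, \val (f z) = Gam x a y b (\val z)) -> linear f.
Proof.
move=> xa yb.
apply: (semistructural_linear _ (Gam_right_swapE xa yb) (Gam_rightE xa yb)).
by have [[]] := @ag_structural K X x a y b b.
Qed.

(** The middle operator and its partner both send [a] to [b], so the operator leads from one module
    to the other and matches their origins. *)
Lemma Gam_linear_mid x z (f : affineU ab -> affineU ba) :
  transverse x a -> transverse z a ->
  (forall y, \val (f y) = Gam x a (\val y) b z) -> linear f.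
Proof.
move=> xa za.
apply: (semistructural_linear (g := fun y => Gam x a y b z)
  (h := fun y => Gam z a y b x) _ (Gam_midE b za xa) (Gam_midE b xa za)).
by have [_ []] := @ag_structural K X x a b b z.
Qed.

Lemma Gam_linear_left y z (f : affineU ba -> affineU ba) :
  transverse y b -> transverse z a ->
  (forall x, \val (f x) = Gam (\val x) a y b z) -> linear f.
Proof.
move=> yb za.
apply: (semistructural_linear (g := fun x => Gam x a y b z)
  (h := fun x => Gam x a z b y)).
- by have [_ _ []] := @ag_structural K X b a y b z.
(* Reversing the arguments gives the values already known for the right operator, with [a] and [b]
   exchanged. *)
- by rewrite (ag_klein _ _ _ _ _).1 Gam_rightE.
- by rewrite (ag_klein _ _ _ _ _).1 Gam_right_swapE.
Qed.

End TripleLinear.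

Lemma geom_is_assocPair (K : comPzRingType) (X : basedGeom K) :
  is_assocPair (@geom_triplep K X) (@geom_triplem K X).
Proof.
(* Reversal gives the minus product the form of the plus product with the base points exchanged;
   left and right linearity then trade places. *)
have mE (x y z : X) : Gam x (bminus X) y (bplus X) z
    = Gam z (bplus X) y (bminus X) x by rewrite (ag_klein _ _ _ _ _).1.
split.
- split=> [y z|x z|x y].
  + exact: (Gam_linear_left (valP y) (valP z)).
  + exact: (Gam_linear_mid (valP x) (valP z)).
  + exact: (Gam_linear_right (valP x) (valP y)).
- split=> [y z|x z|x y].
  + by apply: (Gam_linear_right (valP z) (valP y)) => x; apply: mE.
  + by apply: (Gam_linear_mid (valP z) (valP x)) => y; apply: mE.
  + by apply: (Gam_linear_left (valP y) (valP x)) => z; apply: mE.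
- by move=> x y z u v; split; apply: val_inj => /=;
    have [-> ->] := @ag_assoc K X (\val x) (\val y) (\val z) (\val u) (\val v)
      (bminus X) (bplus X).
- by move=> x y z u v; split; apply: val_inj => /=;
    have [-> ->] := @ag_assoc K X (\val x) (\val y) (\val z) (\val u) (\val v)
      (bminus X) (bplus X).
Qed.

Lemma geom_is_unitalAlg (K : comPzRingType) (X : tripledGeom K) :
  is_unitalAlg (@geom_mul K X) (geom_unit X).
Proof.
have ua : transverse (tri_b X) (tri_a X) by rewrite transverseC tg_ab.
have uc := tg_bc X.
have [_ _ diag _ _] := @ag_diagonal K X.
split.
(* The origin of the module is [tri_a], so the linearity lemmas are used for the pair [tri_c],
   [tri_a], which reverses the product. *)
- move=> z; apply: (Gam_linear_right (valP z) ua) => x.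
  by rewrite (ag_klein _ _ _ _ _).1.
- move=> x; apply: (Gam_linear_left ua (valP x)) => z.
  by rewrite (ag_klein _ _ _ _ _).1.
(* The outer members of the para-associative law, with both inner factors equal to the unit. *)
- move=> x y z; apply: val_inj => /=.
  by have [-> ->] := @ag_assoc K X (\val x) (tri_b X) (\val y) (tri_b X)
    (\val z) (tri_a X) (tri_c X).
- by move=> z; apply: val_inj; have [] := diag _ _ _ (\val z) ua uc.
- by move=> x; apply: val_inj; have [] := diag _ _ _ (\val x) uc ua.
Qed.

(** * Restriction of homomorphisms to affine parts *)

Section HomTransverse.
Variables (K : comPzRingType) (X Y : assocGeom K) (phi : assocGeomHom X Y).

Lemma agh_join (x y : X) : phi (x `|` y)%O = (phi x `|` phi y)%O.
Proof.
have [jX _ _ _ _] := @ag_diagonal K X; have [jY _ _ _ _] := @ag_diagonal K Y.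
by rewrite -(jX _ _ x) agh_Gam jY.
Qed.

Lemma agh_meet (x y : X) : phi (x `&` y)%O = (phi x `&` phi y)%O.
Proof.
have [_ mX _ _ _] := @ag_diagonal K X; have [_ mY _ _ _] := @ag_diagonal K Y.
by rewrite -(mX _ _ x) agh_Gam mY.
Qed.

(* A homomorphism need not fix \bot and \top, but one preserving a single
   transversal pair does, as these are the meet and join of the pair. *)
Lemma agh_transverse (o a x y : X) : transverse o a ->
  transverse (phi o) (phi a) -> transverse x y -> transverse (phi x) (phi y).
Proof.
rewrite /transverse -!agh_join -!agh_meet.
by move=> /andP[/eqP-> /eqP->] h /andP[/eqP-> /eqP->].
Qed.

Variables (a o : X) (a' o' : Y) (oa : transverse o a) (oa' : transverse o' a').
Hypotheses (pa : phi a = a') (po : phi o = o').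

Lemma agh_affineU_subproof (x : affineU oa) : transverse (phi (\val x)) a'.
Proof. by rewrite -pa (agh_transverse oa) ?pa ?po // (valP x). Qed.

(** The equations [pa] and [po] let the target be the module on the chosen base points of [Y], with
    no transport between dependent types. *)
Definition agh_affineU (x : affineU oa) : affineU oa' :=
  toU oa' (agh_affineU_subproof x).

Lemma agh_affineU_linear : linear agh_affineU.
Proof.
apply: (affineU_linear (h := phi)) => // [p q r|r p q].
  by rewrite agh_Gam pa.
by rewrite agh_Pi pa.
Qed.

HB.instance Definition _ :=
  GRing.isLinear.Build K (affineU oa) (affineU oa') _ agh_affineU
    agh_affineU_linear.

End HomTransverse.

Section Functors.
Variable K : comPzRingType.

Definition geomPair (X : basedGeom K) := AssocPair (geom_is_assocPair X).

Definition geomAlg (X : tripledGeom K) := UnitalAlg (geom_is_unitalAlg X).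

Definition basedHom_plus (X Y : basedGeom K) (phi : basedHom X Y) :
    {linear geomAplus X -> geomAplus Y} :=
  @agh_affineU K X Y phi _ _ _ _ (bg_transversal X) (bg_transversal Y)
    (bgh_minus phi) (bgh_plus phi).

Definition basedHom_minus (X Y : basedGeom K) (phi : basedHom X Y) :
    {linear geomAminus X -> geomAminus Y} :=
  @agh_affineU K X Y phi _ _ _ _ (bg_transversalC X) (bg_transversalC Y)
    (bgh_plus phi) (bgh_minus phi).

Lemma basedHom_triplep (X Y : basedGeom K) (phi : basedHom X Y) x y z :
  basedHom_plus phi (geom_triplep x y z) =
  geom_triplep (basedHom_plus phi x) (basedHom_minus phi y)
    (basedHom_plus phi z).
Proof. by apply: val_inj; rewrite /= agh_Gam bgh_plus bgh_minus. Qed.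

Lemma basedHom_triplem (X Y : basedGeom K) (phi : basedHom X Y) x y z :
  basedHom_minus phi (geom_triplem x y z) =
  geom_triplem (basedHom_minus phi x) (basedHom_plus phi y)
    (basedHom_minus phi z).
Proof. by apply: val_inj; rewrite /= agh_Gam bgh_plus bgh_minus. Qed.

Definition geomPair_hom (X Y : basedGeom K) (phi : basedHom X Y) :
    assocPairHom (geomPair X) (geomPair Y) :=
  @AssocPairHom K (geomPair X) (geomPair Y) (basedHom_plus phi)
    (basedHom_minus phi) (basedHom_triplep phi) (basedHom_triplem phi).

Definition tripledHom_lin (X Y : tripledGeom K) (phi : tripledHom X Y) :
    {linear geomA X -> geomA Y} :=
  @agh_affineU K X Y phi _ _ _ _ (tg_ac X) (tg_ac Y) (tgh_c phi) (tgh_a phi).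

Lemma tripledHom_mul (X Y : tripledGeom K) (phi : tripledHom X Y) x y :
  tripledHom_lin phi (geom_mul x y) =
  geom_mul (tripledHom_lin phi x) (tripledHom_lin phi y).
Proof. by apply: val_inj; rewrite /= agh_Gam tgh_a tgh_b tgh_c. Qed.

Lemma tripledHom_unit (X Y : tripledGeom K) (phi : tripledHom X Y) :
  tripledHom_lin phi (geom_unit X) = geom_unit Y.
Proof. by apply: val_inj; rewrite /= tgh_b. Qed.

Definition geomAlg_hom (X Y : tripledGeom K) (phi : tripledHom X Y) :
    unitalAlgHom (geomAlg X) (geomAlg Y) :=
  @UnitalAlgHom K (geomAlg X) (geomAlg Y) (tripledHom_lin phi)
    (tripledHom_mul phi) (tripledHom_unit phi).

End Functors.

Theorem theorem3p3 (K : comPzRingType) :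
  (exists isAP : forall X : basedGeom K,
      is_assocPair (@geom_triplep K X) (@geom_triplem K X),
    let AP := fun X : basedGeom K => AssocPair (isAP X) in
    exists F : forall X Y : basedGeom K,
        basedHom X Y -> assocPairHom (AP X) (AP Y),
      [/\ forall (X Y : basedGeom K) (phi : basedHom X Y),
            (forall x : geomAplus X,
               \val (aph_plus (F X Y phi) x : geomAplus Y) = phi (\val x)) /\
            (forall y : geomAminus X,
               \val (aph_minus (F X Y phi) y : geomAminus Y) = phi (\val y)),
          forall X : basedGeom K,
            aph_plus (F X X (bgh_id X)) =1 id /\
            aph_minus (F X X (bgh_id X)) =1 id &
          forall (X Y Z : basedGeom K) (g : basedHom Y Z) (f : basedHom X Y),
            aph_plus (F X Z (bgh_comp g f)) =1
              aph_plus (F Y Z g) \o aph_plus (F X Y f) /\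
            aph_minus (F X Z (bgh_comp g f)) =1
              aph_minus (F Y Z g) \o aph_minus (F X Y f)])
  /\
  (exists isUA : forall X : tripledGeom K,
      is_unitalAlg (@geom_mul K X) (geom_unit X),
    let UA := fun X : tripledGeom K => UnitalAlg (isUA X) in
    exists F : forall X Y : tripledGeom K,
        tripledHom X Y -> unitalAlgHom (UA X) (UA Y),
      [/\ forall (X Y : tripledGeom K) (phi : tripledHom X Y) (x : geomA X),
            \val (F X Y phi x : geomA Y) = phi (\val x),
          forall X : tripledGeom K, F X X (tgh_id X) =1 id &
          forall (X Y Z : tripledGeom K) (g : tripledHom Y Z)
                 (f : tripledHom X Y),
            F X Z (tgh_comp g f) =1 F Y Z g \o F X Y f]).
Proof.
split.
  exists (@geom_is_assocPair K); cbv zeta; exists (@geomPair_hom K).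
  split=> [X Y phi|X|X Y Z g f].
  - by split.
  (* The restricted maps are compared on underlying elements, where both sides agree by
     computation. *)
  - by split=> x; apply: val_inj.
  - by split=> x; apply: val_inj.
exists (@geom_is_unitalAlg K); cbv zeta; exists (@geomAlg_hom K).
by split=> [X Y phi x|X x|X Y Z g f x] //; apply: val_inj.
Qed.
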